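(* For every $q>1$ there is a constant $C_q>0$, depending only on $q$, such that the following holds. Let $t\in\mathbb{R}$, let $m,n\ge 0$ be integers, and let $w$ be a weight on $\mathbb{R}$ such that $w\in C^d_{2t}$ and $w^{2t}\in A^d_q$. Then for all $f\in L^2(\mathbb{R})$, $$\|T^{m,n}_{t,w}f\|_{L^2(\mathbb{R})}\le C_q\,(m+n+2)^3\,[w]_{C^d_{2t}}^{1/2}\,[w^{2t}]_{A^d_q}^{1/2}\,\|f\|_{L^2(\mathbb{R})}.$$
   Context: A weight is a locally integrable function on $\mathbb{R}$ that is positive almost everywhere. $|E|$ is Lebesgue measure and $m_Ig=\frac{1}{|I|}\int_I g(x)\,dx$. $\mathcal{D}$ is the collection of dyadic intervals $[k2^{-j},(k+1)2^{-j})$, $j,k\in\mathbb{Z}$. For $L\in\mathcal{D}$ and an integer $m\ge0$, $\mathcal{D}_m(L)$ is the set of dyadic intervals $I\subset L$ with $|I|=2^{-m}|L|$. For $I\in\mathcal{D}$ with right and left halves $I_+$, $I_-$, the Haar function is $h_I=|I|^{-1/2}(\chi_{I_+}-\chi_{I_-})$. $\langle\cdot,\cdot\rangle$ is the inner product of $L^2(\mathbb{R})$. Dyadic Muckenhoupt class: for $1<q<\infty$, a weight $v$ is in $A^d_q$ if $[v]_{A^d_q}:=\sup_{I\in\mathcal{D}}(m_Iv)\,(m_Iv^{-1/(q-1)})^{q-1}<\infty$. $C^d_s$ class: for $s\in\mathbb{R}$, a weight $w$ is in $C^d_s$ if $[w]_{C^d_s}:=\sup_{I\in\mathcal{D}}(m_Iw^s)(m_Iw)^{-s}<\infty$.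 The $t$-Haar multiplier of complexity $(m,n)$ associated to $w$ is defined formally by $$T^{m,n}_{t,w}f(x)=\sum_{L\in\mathcal{D}}\ \sum_{I\in\mathcal{D}_m(L),\,J\in\mathcal{D}_n(L)}\frac{\sqrt{|I|\,|J|}}{|L|}\,\frac{w^t(x)}{(m_Lw)^t}\,\langle f,h_I\rangle\,h_J(x).$$ It is understood in the weak sense, through the form $\langle T^{m,n}_{t,w}f,g\rangle=\sum_{L}\sum_{I,J}\frac{\sqrt{|I||J|}}{|L|}(m_Lw)^{-t}\langle f,h_I\rangle\langle w^th_J,g\rangle$ for $f,g\in L^2(\mathbb{R})$; the norm bound means that this series converges absolutely and is bounded in absolute value by the stated constant times $\|f\|_{L^2}\|g\|_{L^2}$. *)

(* Defs.v *)
From HB Require Import structures.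
From mathcomp Require Import all_boot all_order all_algebra.
From mathcomp Require Import all_classical all_reals all_analysis.

Set Implicit Arguments.
Unset Strict Implicit.
Unset Printing Implicit Defensive.
Import Order.TTheory GRing.Theory Num.Theory.
Import numFieldNormedType.Exports.

Local Open Scope classical_set_scope.
Local Open Scope ring_scope.

(* The pair (j, k) stands for [k 2^-j, (k+1) 2^-j[; distinct pairs give distinct
   intervals, so families indexed by D are families indexed by these pairs. *)
Definition dyadic : Type := (int * int)%type.

Definition dset (R : realType) (I : dyadic) : set R :=
  `[I.2%:~R * 2 ^ (- I.1), (I.2 + 1)%:~R * 2 ^ (- I.1)[.
Arguments dset : clear implicits.

Definition dlen (R : realType) (I : dyadic) : R :=
  fine (lebesgue_measure (dset R I)).
Arguments dlen : clear implicits.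

Definition left_half (I : dyadic) : dyadic := (I.1 + 1, 2 * I.2).
Definition right_half (I : dyadic) : dyadic := (I.1 + 1, 2 * I.2 + 1).

Definition descendants (R : realType) (m : nat) (L : dyadic) : set dyadic :=
  [set I | dset R I `<=` dset R L /\ dlen R I = 2 ^- m * dlen R L].

Definition haar (R : realType) (I : dyadic) (x : R) : R :=
  (Num.sqrt (dlen R I))^-1 *
  (\1_(dset R (right_half I)) x - \1_(dset R (left_half I)) x).

Definition inner (R : realType) (f g : R -> R) : R :=
  \int[lebesgue_measure]_x (f x * g x).

Definition weight (R : realType) (w : R -> R) : Prop :=
  locally_integrable [set: R] w /\ {ae lebesgue_measure, forall x, 0 < w x}.

(* Extended-real valued: powers of a weight need not be locally integrable. *)
Definition emean (R : realType) (I : dyadic) (g : R -> R) : \bar R :=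
  ((dlen R I)^-1%:E * \int[lebesgue_measure]_(x in dset R I) (g x)%:E)%E.

Definition mean (R : realType) (I : dyadic) (g : R -> R) : R :=
  fine (emean I g).

Definition wpow (R : realType) (w : R -> R) (s : R) : R -> R :=
  fun x => w x `^ s.

Definition Ad_char (R : realType) (q : R) (v : R -> R) : \bar R :=
  ereal_sup [set (emean I v * emean I (wpow v (- (q - 1)^-1)) `^ (q - 1))%E
            | I in [set: dyadic]].

Definition Ad_class (R : realType) (q : R) (v : R -> R) : Prop :=
  weight v /\ (Ad_char q v < +oo)%E.

Definition Cd_char (R : realType) (s : R) (w : R -> R) : \bar R :=
  ereal_sup [set (emean I (wpow w s) * emean I w `^ (- s))%E
            | I in [set: dyadic]].

Definition Cd_class (R : realType) (s : R) (w : R -> R) : Prop :=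
  weight w /\ (Cd_char s w < +oo)%E.

Definition form_index (R : realType) (m n : nat) :
    set (dyadic * dyadic * dyadic) :=
  [set LIJ | let L := LIJ.1.1 in
             descendants R m L LIJ.1.2 /\ descendants R n L LIJ.2].

Definition form_term (R : realType) (t : R) (w f g : R -> R)
    (LIJ : dyadic * dyadic * dyadic) : R :=
  let L := LIJ.1.1 in let I := LIJ.1.2 in let J := LIJ.2 in
  Num.sqrt (dlen R I * dlen R J) / dlen R L * mean L w `^ (- t) *
  inner f (haar I) * inner (fun x => wpow w t x * haar J x) g.

Definition form_abs_cvg (R : realType) (m n : nat) (t : R) (w f g : R -> R) :
    Prop :=
  summable (form_index R m n) (EFin \o form_term t w f g).

(* The form <T^{m,n}_{t,w} f, g>, i.e. the sum of the above family; meaningful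
   under form_abs_cvg. *)
Definition haar_form (R : realType) (m n : nat) (t : R) (w f g : R -> R) :
    \bar R :=
  (esum (form_index R m n) (EFin \o form_term t w f g)^\+ -
   esum (form_index R m n) (EFin \o form_term t w f g)^\-)%E.

(* Main.v *)
Require Import Defs.
From HB Require Import structures.
From mathcomp Require Import all_boot all_order all_algebra.
From mathcomp Require Import ring lra zify.
From mathcomp Require Import all_classical all_reals all_analysis.
From mathcomp Require Import measurable_realfun.

Set Implicit Arguments.
Unset Strict Implicit.
Unset Printing Implicit Defensive.

Import Order.TTheory GRing.Theory Num.Theory.
Import numFieldNormedType.Exports.

Local Open Scope classical_set_scope.
Local Open Scope ring_scope.

(** Write [v = w ^ (2 t)], [p = q - 1], [u = v ^ (- 1 / p)], [Q] for the A_q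
    characteristic of [v], and [G = g w ^ t], so that [(w ^ t) ^ 2 = v].

    The C_2t condition says exactly that [(m_L w) ^ (- t)] is at most
    [c ^ (1/2) (m_L v) ^ (- 1/2)], with [c] the C_2t characteristic.  For any
    [e > 0] the geometric-arithmetic mean inequality then bounds the term of
    index (L, I, J) by [c ^ (1/2) / 2] times

      [e <f, h_I> ^ 2 (|J| m_J v) / (|L| m_L v)
         + e ^ (-1) (<G, h_J> ^ 2 / m_J v) |I| / |L|].

    For fixed L, the masses [|J| m_J v] of the J of one generation add up to
    [|L| m_L v], and the lengths [|I|] to [|L|].  Summing the first summand
    over J and the second over I thus leaves [e <f, h_I> ^ 2] and
    [e ^ (-1) <G, h_J> ^ 2 / m_J v]; since I determines L, and so does J, the
    total is controlled, whatever the complexity, by Bessel's inequality for f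
    and by the weighted square function estimate

      [sum_J <g v ^ (1/2), h_J> ^ 2 / m_J v <= (2 + 2304 Q) ||g|| ^ 2]

    ([haar_square_sum]), whose case v = 1 is Bessel's inequality.  Optimising
    in [e] gives the product of the norms ([le_of_amgm], [form_sum_le]).

    The square function estimate is proved with a Bellman function.  Let x, y
    be the means of [g ^ 2] and [g v ^ (1/2)] over a dyadic interval, and write
    v, u also for the means of v and u.  Then [y ^ 2 <= x v] by Cauchy-Schwarz,
    and [1 <= v u ^ p <= Q] by Jensen and the A_q condition.  Let the means over
    the two halves be [y + d], [y - d] and [v + e], [v - e]; a function of the
    means gains what the average of its values on the halves exceeds its value
    on the whole interval by.  The function [y ^ 2 / v] is convex and gains at
    least [(d - (y / v) e) ^ 2 / v].  To control [d ^ 2 / v] it remains to gain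
    [(y / v) ^ 2 e ^ 2 / v], a Carleson embedding.  For this one needs a
    function [F (v, u)] between 0 and [2 v] which gains a multiple of
    [e ^ 2 / (Q v)]; then [y ^ 2 / (3 v - F)] has the required gain up to the
    factor [1 / Q] ([bellman_step]).  The choice

      [F (v, u) = u ^ (- p) + v / (16 Q) (ln v + p ln u)]

    works on the domain [1 <= v u ^ p <= Q] ([bellman_corr_gain]).  The term
    [v ln v] produces the gain; [p v ln u], which is not convex, makes F
    nonnegative, and its defect is absorbed by the convex term [u ^ (- p)],
    which is at least [v / Q].  Summing the one-step inequality along the
    binary tree below a dyadic interval, and using that finitely many dyadic
    intervals lie below one large interval on each side of 0, gives the
    estimate ([square_sum_le]). *)

(** * A correction term convex along dyadic splittings *)

(** The second order gain of [x ln x] under a splitting of 1 into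
    [1 + a] and [1 - a].  The tangent bound [ln x >= 1 - 1 / x] only gives 0;
    applied to the square root of x it gives the quadratic term. *)
Lemma xlnx_pair_lb (R : realType) (a : R) : -1 < a -> a < 1 ->
  a ^+ 2 / 2 <= (1 + a) * ln (1 + a) + (1 - a) * ln (1 - a).
Proof.
move=> a1 a2.
pose s := Num.sqrt (1 + a); pose r := Num.sqrt (1 - a).
have s0 : 0 < s by rewrite sqrtr_gt0; lra.
have r0 : 0 < r by rewrite sqrtr_gt0; lra.
have s2 : s ^+ 2 = 1 + a by rewrite sqr_sqrtr//; lra.
have r2 : r ^+ 2 = 1 - a by rewrite sqr_sqrtr//; lra.
(* [ln (z ^ 2) = 2 ln z >= 2 (1 - 1 / z)] *)
have ln_lb (z : R) : 0 < z -> 2 * (z ^+ 2 - z) <= z ^+ 2 * ln (z ^+ 2).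
  move=> z0; rewrite lnXn// -[ln z *+ 2]mulr_natl [leRHS]mulrCA.
  have lz : - ln z <= z^-1 - 1.
    have zi : 0 < z^-1 by rewrite invr_gt0.
    rewrite -lnV ?posrE//.
    have := @le_ln1Dx R (z^-1 - 1).
    have -> : 1 + (z^-1 - 1) = z^-1 by ring.
    by apply; rewrite ltrBrDr addNr.
  rewrite ler_pM2l//.
  have -> : z ^+ 2 - z = z ^+ 2 * (1 - z^-1).
    by rewrite mulrBr mulr1 expr2 mulfK// gt_eqF.
  by rewrite ler_pM2l ?exprn_gt0//; lra.
rewrite -s2 -r2; apply: le_trans (lerD (ln_lb _ s0) (ln_lb _ r0)).
have P : (s * r) ^+ 2 = 1 - a ^+ 2 by rewrite exprMn s2 r2; ring.
have P1 : s * r <= 1 - a ^+ 2 / 2.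
  rewrite -(@ler_pXn2r _ 2)// ?nnegrE; [|by rewrite mulr_ge0// ltW|by nra].
  have -> : (1 - a ^+ 2 / 2) ^+ 2 = 1 - a ^+ 2 + (a ^+ 2 / 2) ^+ 2 by field.
  by rewrite P lerDl sqr_ge0.
have := sqr_ge0 (s + r - 2); lra.
Qed.

Lemma cosh_lb (R : realType) (h : R) : 2 + h ^+ 2 / 4 <= expR h + expR (- h).
Proof.
wlog h0 : h / 0 <= h.
  move=> H; have [h0|h0] := leP 0 h; first exact: H.
  have := H (- h); rewrite opprK sqrrN [expR (- h) + _]addrC; apply.
  by rewrite oppr_ge0 ltW.
have e1 := expR_ge1Dx (h / 2).
have e2 : expR (- (h / 2)) <= 1 by rewrite expR_le1; lra.
have e3 : 0 < expR (- (h / 2)) := expR_gt0 _.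
have E : expR (h / 2) * expR (- (h / 2)) = 1 := expRxMexpNx_1 _.
have -> : h = h / 2 + h / 2 by field.
rewrite opprD !expRD.
nra.
Qed.

(** The function F above.  Scaling v by s and u by [s ^ (- 1 / p)] leaves
    [v u ^ p] fixed and multiplies F by s, so that multiples of v are its
    natural bounds. *)
Definition bellman_corr (R : realType) (p Q v u : R) : R :=
  u `^ (- p) + v / (16 * Q) * (ln v + p * ln u).

(** With [A = ln (1 + b)], [B = ln (1 - b)], [A + B <= 0], the term
    [u ^ (- p)] gains [u ^ (- p)] times at least
    [- p (A + B) + p ^ 2 (A - B) ^ 2 / 16].  The logarithmic term gains
    [v / (16 Q)] times at least [a ^ 2 / 2 + p (A + B) + p a (A - B)].  As
    [u ^ (- p) >= v / Q], the first gain dominates the negative part of the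
    second, the cross term being split by the inequality between the means.
    The segment joining the two halves need not stay in the domain, and only
    the condition at the centre enters. *)
Lemma bellman_corr_gain (R : realType) (p Q v u a b : R) :
  0 < p -> 0 < v -> 0 < u -> `|a| < 1 -> `|b| < 1 -> 1 <= v * u `^ p ->
  v * u `^ p <= Q ->
  2 * bellman_corr p Q v u + v * a ^+ 2 / (64 * Q) <=
  bellman_corr p Q (v * (1 + a)) (u * (1 + b)) +
  bellman_corr p Q (v * (1 - a)) (u * (1 - b)).
Proof.
rewrite !ltr_norml => p0 v0 u0 /andP[a1 a2] /andP[b1 b2] vu1 vuQ.
have Q0 : 0 < Q by lra.
have a3 : 0 < 1 + a by lra.
have a4 : 0 < 1 - a by lra.
have b3 : 0 < 1 + b by lra.
have b4 : 0 < 1 - b by lra.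
rewrite /bellman_corr !lnM ?posrE// !(powRM _ (ltW _) (ltW _))//.
have powE (z : R) : 0 < z -> z `^ (- p) = expR (- p * ln z).
  by move=> z0; rewrite /powR gt_eqF.
rewrite (powE (1 + b))// (powE (1 - b))//.
have G := xlnx_pair_lb a1 a2.
set A := ln (1 + b); set B := ln (1 - b).
have AB : A + B <= 0.
  rewrite /A /B -lnM ?posrE//; apply: ln_le0; nra.
set la := ln (1 + a) in G *; set lb := ln (1 - a) in G *.
have E : 2 - p * (A + B) + p ^+ 2 * (A - B) ^+ 2 / 16
     <= expR (- p * A) + expR (- p * B).
  have -> : - p * A = - (p * (A + B) / 2) - p * (A - B) / 2 by field.
  have -> : - p * B = - (p * (A + B) / 2) + p * (A - B) / 2 by field.
  rewrite !expRD -mulrDr [expR (- (p * (A - B) / 2)) + _]addrC.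
  have := cosh_lb (p * (A - B) / 2).
  have := expR_ge1Dx (- (p * (A + B) / 2)).
  set c := expR _ + _; set e := expR _; set m := - (p * (A + B) / 2).
  have m0 : 0 <= m by rewrite /m; nra.
  set h := p * (A - B) / 2.
  have -> : 2 - p * (A + B) + p ^+ 2 * (A - B) ^+ 2 / 16 = 2 + 2 * m + h ^+ 2 / 4.
    by rewrite /m /h; field.
  have := sqr_ge0 h.
  nra.
set T := v / Q.
have T0 : 0 < T by rewrite divr_gt0.
have TU : T <= u `^ (- p).
  rewrite powRN ler_pdivrMr// mulrC ler_pdivlMr// powR_gt0//.
set U := u `^ (- p) in TU *.
set eA := expR _ in E *; set eB := expR _ in E *.
have -> : v / (16 * Q) = T / 16 by rewrite /T; field; rewrite gt_eqF.
have -> : v * (1 + a) / (16 * Q) = T / 16 * (1 + a).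
  by rewrite /T; field; rewrite gt_eqF.
have -> : v * (1 - a) / (16 * Q) = T / 16 * (1 - a).
  by rewrite /T; field; rewrite gt_eqF.
have -> : v * a ^+ 2 / (64 * Q) = T * (a ^+ 2 / 64).
  by rewrite /T; field; rewrite gt_eqF.
set S := eA + eB - 2.
have pAB : p * (A + B) <= 0 by rewrite mulr_ge0_le0// ltW.
have S0 : 0 <= S.
  by have := sqr_ge0 (p * (A - B)); rewrite exprMn /S; lra.
have : T * S <= U * S by rewrite ler_wpM2r.
have K : a ^+ 2 / 64 <= S + ((1 + a) * la + (1 - a) * lb
          + p * (A + B) + a * (p * (A - B))) / 16.
  set z := p * (A - B).
  have Z : 2 - p * (A + B) + z ^+ 2 / 16 <= eA + eB.
    by move: E; rewrite /z exprMn.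
  have := sqr_ge0 (a / 2 + z); rewrite /S.
  nra.
have : T * (a ^+ 2 / 64) <= T * (S + ((1 + a) * la + (1 - a) * lb
          + p * (A + B) + a * (p * (A - B))) / 16) by rewrite ler_pM2l.
set lv := ln v; set lu := ln u.
rewrite /S; lra.
Qed.

Lemma bellman_corr_bounds (R : realType) (p Q v u : R) :
  0 < v -> 0 < u -> 1 <= v * u `^ p -> v * u `^ p <= Q ->
  0 <= bellman_corr p Q v u <= 2 * v.
Proof.
move=> v0 u0 vu1 vuQ.
have Q0 : 0 < Q by lra.
have up : 0 < u `^ p by rewrite powR_gt0.
rewrite /bellman_corr -[p * ln u]ln_powR -lnM ?posrE//.
have l0 := ln_ge0 vu1.
have l1 : ln (v * u `^ p) <= Q.
  by apply: le_trans vuQ; apply/ltW/ln_sublinear/mulr_gt0.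
rewrite powRN; apply/andP; split.
  by rewrite addr_ge0// ?invr_ge0 ?(ltW up)// mulr_ge0// divr_ge0//; lra.
have -> : 2 * v = v + v by ring.
apply: lerD.
  by rewrite -[leLHS]mul1r ler_pdivrMr.
rewrite -[leRHS]mulr1 -mulrA ler_pM2l// mulrC ler_pdivrMr; lra.
Qed.

(** * The Bellman function of the weighted square function *)

(** Convexity of [y ^ 2 / v], in the form of a lower bound linear in (y, v). *)
Lemma sqr_div_tangent (R : realFieldType) (c y v : R) : 0 < v ->
  2 * c * y - c ^+ 2 * v <= y ^+ 2 / v.
Proof.
move=> v0; rewrite -subr_ge0.
have -> : y ^+ 2 / v - (2 * c * y - c ^+ 2 * v) = (y - c * v) ^+ 2 / v.
  by field; rewrite gt_eqF.
by rewrite divr_ge0 ?sqr_ge0// ltW.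
Qed.

(** The coefficient [2304 Q] is the one for which the gain of the last term,
    at least [e ^ 2 / (128 Q v) (y / (3 v)) ^ 2] times it, is
    [2 (y / v) ^ 2 e ^ 2 / v]. *)
Definition bellman (R : realType) (p Q x y v u : R) : R :=
  (2 + 2304 * Q) * x - 2 * (y ^+ 2 / v)
  - 2304 * Q * (y ^+ 2 / (3 * v - bellman_corr p Q v u)).

(** The three terms of [bellman] are matched as follows: [GA] is the gain of
    [y ^ 2 / v], [GB] that of [y ^ 2 / s] with [s = 3 v - F], [GC] rewrites
    the latter through [s <= 3 v], and [GD] recombines them, because
    [d = (d - l e) + l e] with [l = y / v]. *)
Lemma bellman_step (R : realType) (p Q : R) (x y v u x1 y1 v1 u1 x2 y2 v2 u2 : R) :
  0 < p -> 0 < v1 -> 0 < v2 -> 0 < u1 -> 0 < u2 ->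
  x = (x1 + x2) / 2 -> y = (y1 + y2) / 2 -> v = (v1 + v2) / 2 ->
  u = (u1 + u2) / 2 ->
  1 <= v * u `^ p <= Q -> 1 <= v1 * u1 `^ p <= Q -> 1 <= v2 * u2 `^ p <= Q ->
  ((y1 - y2) / 2) ^+ 2 / v +
    (bellman p Q x1 y1 v1 u1 + bellman p Q x2 y2 v2 u2) / 2 <=
  bellman p Q x y v u.
Proof.
move=> p0 v10 v20 u10 u20 xE yE vE uE /andP[vu vuQ] /andP[vu1 vuQ1] /andP[vu2 vuQ2].
have v0 : 0 < v by lra.
have u0 : 0 < u by lra.
have Q0 : 0 < Q by lra.
have K0 : 0 <= 1152 * Q by lra.
have Qx : Q * x = (Q * x1 + Q * x2) / 2 by rewrite xE; field.
have /andP[F0 F1] := bellman_corr_bounds v0 u0 vu vuQ.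
have /andP[F10 F11] := bellman_corr_bounds v10 u10 vu1 vuQ1.
have /andP[F20 F21] := bellman_corr_bounds v20 u20 vu2 vuQ2.
pose e := (v1 - v2) / 2; pose d := (y1 - y2) / 2.
pose a := e / v; pose b := (u1 - u2) / 2 / u.
have va : v * a = e by rewrite /a; field; rewrite gt_eqF.
have ub : u * b = (u1 - u2) / 2 by rewrite /b; field; rewrite gt_eqF.
have a1 : `|a| < 1.
  by rewrite ltr_norml /a ltr_pdivlMr// ltr_pdivrMr// /e; lra.
have b1 : `|b| < 1.
  by rewrite ltr_norml /b ltr_pdivlMr// ltr_pdivrMr//; lra.
have := bellman_corr_gain p0 v0 u0 a1 b1 vu vuQ.
have -> : v * (1 + a) = v1 by rewrite mulrDr va /e; lra.
have -> : v * (1 - a) = v2 by rewrite mulrBr va /e; lra.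
have -> : u * (1 + b) = u1 by rewrite mulrDr ub; lra.
have -> : u * (1 - b) = u2 by rewrite mulrBr ub; lra.
set F := bellman_corr p Q v u in F0 F1 *.
set G1 := bellman_corr p Q v1 u1 in F10 F11 *.
set G2 := bellman_corr p Q v2 u2 in F20 F21 *.
have -> : v * a ^+ 2 / (64 * Q) = e ^+ 2 / (64 * Q * v).
  by rewrite /a; field; rewrite !gt_eqF.
move=> gain.
pose s := 3 * v - F; pose s1 := 3 * v1 - G1; pose s2 := 3 * v2 - G2.
have s0 : 0 < s by rewrite /s; lra.
have s10 : 0 < s1 by rewrite /s1; lra.
have s20 : 0 < s2 by rewrite /s2; lra.
have s3 : s <= 3 * v by rewrite /s; lra.
pose l := y / v.
have lv : l * v = y by rewrite /l; field; rewrite gt_eqF.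
pose mu := (d - l * e) / v.
have muv : mu * v = d - l * e by rewrite /mu; field; rewrite gt_eqF.
(* The slopes l + mu and l - mu are optimal for the two tangents. *)
have GA : 2 * (y ^+ 2 / v) + 2 * ((d - l * e) ^+ 2 / v)
    <= y1 ^+ 2 / v1 + y2 ^+ 2 / v2.
  apply: le_trans (lerD (sqr_div_tangent (l + mu) y1 v10)
                        (sqr_div_tangent (l - mu) y2 v20)).
  rewrite le_eqVlt; apply/orP; left; apply/eqP.
  have -> : y1 = y + d by rewrite /d; lra.
  have -> : y2 = y - d by rewrite /d; lra.
  have -> : v1 = v + e by rewrite /e; lra.
  have -> : v2 = v - e by rewrite /e; lra.
  by rewrite /mu /l; field; rewrite gt_eqF.
have GB : 2 * (y ^+ 2 / s) + e ^+ 2 / (64 * Q * v) * (y / s) ^+ 2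
    <= y1 ^+ 2 / s1 + y2 ^+ 2 / s2.
  apply: le_trans (lerD (sqr_div_tangent (y / s) y1 s10)
                        (sqr_div_tangent (y / s) y2 s20)).
  have : (y / s) ^+ 2 * (s1 + s2) <= (y / s) ^+ 2 * (2 * s - e ^+ 2 / (64 * Q * v)).
    by rewrite ler_wpM2l ?sqr_ge0// /s1 /s2 /s; lra.
  have : 2 * (y / s) * (y1 + y2) = 4 * (y ^+ 2 / s).
    by rewrite yE; field; rewrite gt_eqF.
  have : (y / s) ^+ 2 * s = y ^+ 2 / s by field; rewrite gt_eqF.
  set ys := y / s; set k := e ^+ 2 / _; lra.
have GC : l ^+ 2 * e ^+ 2 / v * 2 <= 1152 * Q * (e ^+ 2 / (64 * Q * v) * (y / s) ^+ 2).
  have : (l / 3) ^+ 2 <= (y / s) ^+ 2.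
    have -> : (y / s) ^+ 2 = l ^+ 2 * (v / s) ^+ 2 by rewrite -lv -exprMn mulrA.
    rewrite exprMn ler_wpM2l ?sqr_ge0//.
    rewrite ler_pXn2r// ?nnegrE; [|lra|by rewrite divr_ge0// ltW].
    by rewrite ler_pdivlMr// mulrC ler_pdivrMr// mulrC.
  have : 0 <= 18 * e ^+ 2 / v by rewrite divr_ge0 ?(ltW v0)// mulr_ge0// sqr_ge0.
  have -> : 1152 * Q * (e ^+ 2 / (64 * Q * v) * (y / s) ^+ 2) =
    18 * e ^+ 2 / v * (y / s) ^+ 2.
    by field; rewrite !gt_eqF.
  move=> h1 h2; apply: le_trans (ler_wpM2l h1 h2).
  rewrite le_eqVlt; apply/orP; left; apply/eqP.
  by field; rewrite gt_eqF.
have GD : d ^+ 2 / v <= 2 * ((d - l * e) ^+ 2 / v) + l ^+ 2 * e ^+ 2 / v * 2.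
  rewrite -subr_ge0.
  have -> : 2 * ((d - l * e) ^+ 2 / v) + l ^+ 2 * e ^+ 2 / v * 2 - d ^+ 2 / v
     = (d - 2 * l * e) ^+ 2 / v by field; rewrite gt_eqF.
  by rewrite divr_ge0 ?sqr_ge0// ltW.
have GB' : 1152 * Q * (2 * (y ^+ 2 / s) + e ^+ 2 / (64 * Q * v) * (y / s) ^+ 2)
    <= 1152 * Q * (y1 ^+ 2 / s1 + y2 ^+ 2 / s2).
  exact: (ler_wpM2l K0 GB).
(* The conclusion is linear in the quotients bounded above. *)
change (d ^+ 2 / v +
  ((2 + 2304 * Q) * x1 - 2 * (y1 ^+ 2 / v1) - 2304 * Q * (y1 ^+ 2 / s1) +
   ((2 + 2304 * Q) * x2 - 2 * (y2 ^+ 2 / v2) - 2304 * Q * (y2 ^+ 2 / s2))) / 2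
  <= (2 + 2304 * Q) * x - 2 * (y ^+ 2 / v)
     - 2304 * Q * (y ^+ 2 / s)).
move: GA GB' GC GD.
set A1 := _ / v1; set A2 := _ / v2; set A3 := _ / s1; set A4 := _ / s2.
set A5 := y ^+ 2 / v; set A6 := y ^+ 2 / s; set A7 := d ^+ 2 / v.
set A8 := _ / v; set A9 := _ / v; set A10 := _ * (y / s) ^+ 2.
clearbody A1 A2 A3 A4 A5 A6 A7 A8 A9 A10.
clear -xE Qx A1 A2 A3 A4 A5 A6 A7 A8 A9 A10.
lra.
Qed.

Lemma bellman_ge0 (R : realType) (p Q x y v u : R) :
  0 < v -> 0 < u -> 1 <= v * u `^ p <= Q -> y ^+ 2 <= x * v ->
  0 <= bellman p Q x y v u <= (2 + 2304 * Q) * x.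
Proof.
move=> v0 u0 /andP[vu1 vuQ] yxv.
have Q0 : 0 < Q by lra.
have /andP[F0 F1] := bellman_corr_bounds v0 u0 vu1 vuQ.
rewrite /bellman; set s := 3 * v - _.
have vs : v <= s by rewrite /s; lra.
have s0 : 0 < s by lra.
have K0 : 0 <= 2304 * Q by lra.
have A : y ^+ 2 / v <= x by rewrite ler_pdivrMr.
have B : y ^+ 2 / s <= y ^+ 2 / v by rewrite ler_wpM2l ?sqr_ge0// lef_pV2.
have C : 0 <= y ^+ 2 / s by rewrite divr_ge0 ?sqr_ge0// ltW.
have D : 2304 * Q * (y ^+ 2 / s) <= 2304 * Q * x := ler_wpM2l K0 (le_trans B A).
have E : 0 <= 2304 * Q * (y ^+ 2 / s) := mulr_ge0 K0 C.
have F : 0 <= y ^+ 2 / v := le_trans C B.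
move: A C D E F; set k := y ^+ 2 / v; set l := y ^+ 2 / s => A C D E F.
by apply/andP; split; lra.
Qed.

(** * Finite binary trees of dyadic intervals *)

Fixpoint dtree (N : nat) (I : dyadic) : seq dyadic :=
  if N is N'.+1 then I :: dtree N' (left_half I) ++ dtree N' (right_half I)
  else [::].

Definition dparent (I : dyadic) : dyadic := (I.1 - 1, (I.2 %/ 2)%Z).

Lemma dparent_half (I : dyadic) :
  I = left_half (dparent I) \/ I = right_half (dparent I).
Proof.
case: I => j k; rewrite /left_half /right_half /dparent /= subrK.
have := divz_eq k 2; rewrite mulrC.
have : (0 <= (k %% 2)%Z < 2)%R by rewrite modz_ge0//= ltz_mod.
move: (k %% 2)%Z => r r2 kE.
have [r0|r1] : r = 0 \/ r = 1 by lia.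
- by left; rewrite {1}kE r0 addr0.
- by right; rewrite {1}kE r1.
Qed.

Lemma mem_dtree_half (N : nat) (I J : dyadic) : J \in dtree N I ->
  (left_half J \in dtree N.+1 I) /\ (right_half J \in dtree N.+1 I).
Proof.
elim: N I => // N IH I; rewrite [dtree N.+1 I]/= inE mem_cat.
change (dtree N.+2 I) with (I :: dtree N.+1 (left_half I) ++ dtree N.+1 (right_half I)).
case/or3P=> [/eqP ->|/IH[h1 h2]|/IH[h1 h2]].
- by rewrite /= !(inE, mem_cat) !eqxx !orbT.
- by split; rewrite in_cons mem_cat ?h1 ?h2 !orbT.
- by split; rewrite in_cons mem_cat ?h1 ?h2 !orbT.
Qed.

Lemma mem_dtree_iter (d : nat) (J : dyadic) : J \in dtree d.+1 (iter d dparent J).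
Proof.
elim: d J => [|d IH] J; first by rewrite inE.
rewrite iterSr; have [h1 h2] := mem_dtree_half (IH (dparent J)).
by have [JE|JE] := dparent_half J; rewrite {1}JE.
Qed.

Lemma iter_dparent_fst (d : nat) (J : dyadic) : (iter d dparent J).1 = J.1 - d%:Z.
Proof. by elim: d => [|d IH]; rewrite ?subr0//= IH; lia. Qed.

(** Halving repeatedly and rounding down sends every integer to 0 or to -1:
    a dyadic interval ends up in the interval that starts or ends at 0. *)
Lemma iter_dparent_snd (d : nat) (J : dyadic) : - d%:Z - 1 <= J.2 <= d%:Z ->
  (iter d dparent J).2 = 0 \/ (iter d dparent J).2 = -1.
Proof.
elim: d J => [|d IH] J Jd; first by rewrite /=; lia.
rewrite iterSr; apply: IH => /=.
have := divz_eq J.2 2.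
have : (0 <= (J.2 %% 2)%Z < 2)%R by rewrite modz_ge0//= ltz_mod.
move: Jd; set k := J.2; set r := (k %% 2)%Z; set c := (k %/ 2)%Z; lia.
Qed.

Lemma mem_dtree_le (N N' : nat) (I J : dyadic) : (N <= N')%N ->
  J \in dtree N I -> J \in dtree N' I.
Proof.
elim: N N' I => // N IH [|N'] I//= NN'; rewrite !inE !mem_cat.
by case/or3P=> [->//|/(IH _ _ NN')->|/(IH _ _ NN')->]; rewrite ?orbT.
Qed.

(** No dyadic interval contains 0 in its interior, hence one tree on each
    side of 0 is needed. *)
Lemma finite_sub_dtrees (A : seq dyadic) : exists (K : int) (N : nat),
  {subset A <= dtree N (K, 0) ++ dtree N (K, -1)}.
Proof.
(* M + J.1 steps lead from J to length 2 ^ M; since M >= |J.1| + |J.2|, this is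
   enough for [iter_dparent_snd]. *)
pose M := \max_(J <- A) (absz J.1 + absz J.2)%N.
exists (- M%:Z), (2 * M).+1 => -[j k] JA.
have JM : (absz j + absz k <= M)%N.
  exact: (@leq_bigmax_seq _ A xpredT (fun J : dyadic => absz J.1 + absz J.2)%N (j, k) JA).
pose d := absz (j + M%:Z).
have dE : d%:Z = j + M%:Z by rewrite /d; lia.
have dM : (d.+1 <= (2 * M).+1)%N by lia.
have := mem_dtree_iter d (j, k).
rewrite [iter d dparent _]surjective_pairing iter_dparent_fst.
have -> : (j, k).1 - d%:Z = - M%:Z by rewrite /=; lia.
have [|->|->] := @iter_dparent_snd d (j, k); first by rewrite /=; lia.
- by move=> /(mem_dtree_le dM) h; rewrite mem_cat h.
- by move=> /(mem_dtree_le dM) h; rewrite mem_cat h orbT.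
Qed.

(** * Square sums over dyadic intervals *)

Lemma dlenE (R : realType) (I : dyadic) : dlen R I = 2 ^ (- I.1).
Proof.
rewrite /dlen /dset lebesgue_measure_itv/= lte_fin.
have p0 : 0 < (2 : R) ^ (- I.1) by rewrite exprz_gt0.
rewrite ltr_pM2r// ltr_int ltrDl ltr01 /= -mulrBl -intrB addrAC subrr add0r.
by rewrite mul1r.
Qed.

Lemma dlen_gt0 (R : realType) (I : dyadic) : 0 < dlen R I.
Proof. by rewrite dlenE exprz_gt0. Qed.

Lemma dlen_left_half (R : realType) (I : dyadic) :
  dlen R (left_half I) = dlen R I / 2.
Proof. by rewrite !dlenE /= opprD expfzDr ?exprN1. Qed.

Lemma dlen_right_half (R : realType) (I : dyadic) :
  dlen R (right_half I) = dlen R I / 2.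
Proof. by rewrite !dlenE /= opprD expfzDr ?exprN1. Qed.

Lemma ler_sum_subset (R : numDomainType) (T : eqType) (F : T -> R) (A S : seq T) :
  (forall a, 0 <= F a) -> uniq A -> {subset A <= S} ->
  \sum_(a <- A) F a <= \sum_(a <- S) F a.
Proof.
move=> F0; elim: A S => [|a A IH] S /=; first by rewrite big_nil sumr_ge0.
move=> /andP[aA uA] AS.
have aS : a \in S by apply: AS; rewrite mem_head.
rewrite (perm_big _ (perm_to_rem aS)) !big_cons lerD2l; apply: IH => // b bA.
have ba : b != a by apply: contraNneq aA => <-.
have : b \in S by apply: AS; rewrite inE bA orbT.
by rewrite (perm_mem (perm_to_rem aS)) inE (negbTE ba).
Qed.

Definition dyadic_avg (R : realType) (x : dyadic -> R) : Prop :=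
  forall I, x I = (x (right_half I) + x (left_half I)) / 2.

Section tree_sum.
Variables (R : realType) (p Q : R) (x y v u : dyadic -> R).
Hypotheses (p_gt0 : 0 < p) (x_avg : dyadic_avg x) (y_avg : dyadic_avg y)
  (v_avg : dyadic_avg v) (u_avg : dyadic_avg u).
Hypotheses (v_gt0 : forall I, 0 < v I) (u_gt0 : forall I, 0 < u I)
  (vu : forall I, 1 <= v I * u I `^ p <= Q)
  (yxv : forall I, y I ^+ 2 <= x I * v I).

(** With y, v the means of G and of the weight, this is
    [<G, h_I> ^ 2 / m_I v]. *)
Definition square_term (I : dyadic) : R :=
  dlen R I * (((y (right_half I) - y (left_half I)) / 2) ^+ 2 / v I).

Lemma square_term_ge0 I : 0 <= square_term I.
Proof.
by rewrite mulr_ge0 ?(ltW (dlen_gt0 _ _))// divr_ge0 ?sqr_ge0// ltW.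
Qed.

(** The one-step inequality telescopes; the value left at the leaves is
    nonnegative. *)
Lemma dtree_sum_le (N : nat) (I : dyadic) :
  \sum_(J <- dtree N I) square_term J <=
  dlen R I * bellman p Q (x I) (y I) (v I) (u I).
Proof.
elim: N I => [|N IH] I.
  rewrite big_nil mulr_ge0 ?(ltW (dlen_gt0 _ _))//.
  by have /andP[] := bellman_ge0 (v_gt0 I) (u_gt0 I) (vu I) (yxv I).
rewrite /= big_cons big_cat /=.
have := bellman_step p_gt0 (v_gt0 (right_half I)) (v_gt0 (left_half I))
  (u_gt0 (right_half I)) (u_gt0 (left_half I))
  (x_avg I) (y_avg I) (v_avg I) (u_avg I)
  (vu I) (vu (right_half I)) (vu (left_half I)).
rewrite -(ler_pM2l (dlen_gt0 R I)); apply: le_trans.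
rewrite mulrDr lerD2l.
apply: le_trans (lerD (IH (left_half I)) (IH (right_half I))) _.
rewrite dlen_left_half dlen_right_half.
set a := bellman _ _ _ _ _ _; set b := bellman _ _ _ _ _ _; set l := dlen R I.
lra.
Qed.

Lemma square_sum_le (E : R) (A : seq dyadic) : uniq A ->
  (forall K : int, dlen R (K, 0) * x (K, 0) + dlen R (K, -1) * x (K, -1) <= E) ->
  \sum_(J <- A) square_term J <= (2 + 2304 * Q) * E.
Proof.
move=> uA xE.
have [K [N AKN]] := finite_sub_dtrees A.
have Q0 : 0 <= 2 + 2304 * Q.
  by have /andP[h1 h2] := vu (K, 0); have := le_trans h1 h2; lra.
apply: le_trans (ler_wpM2l Q0 (xE K)).
apply: (@le_trans _ _ (\sum_(J <- dtree N (K, 0) ++ dtree N (K, -1)) square_term J)).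
  exact: ler_sum_subset square_term_ge0 uA AKN.
rewrite big_cat /=.
apply: le_trans (lerD (dtree_sum_le N (K, 0)) (dtree_sum_le N (K, -1))) _.
rewrite [leRHS]mulrDr; apply: lerD; rewrite mulrCA ler_pM2l ?dlen_gt0//.
- by have /andP[] := bellman_ge0 (v_gt0 (K,0)) (u_gt0 _) (vu _) (yxv _).
- by have /andP[] := bellman_ge0 (v_gt0 (K,-1)) (u_gt0 _) (vu _) (yxv _).
Qed.

End tree_sum.

(** * Means and Haar coefficients over dyadic intervals *)

Section dyadic_integrals.
Variable R : realType.
Notation mu := (@lebesgue_measure R).
Implicit Types (I : dyadic) (f g v w : R -> R).

(** Stated for the sigma-algebra that carries Lebesgue measure, whose display
    is not the one of the canonical structure on R. *)
Lemma measurable_dset I : @measurable _ (measurableTypeR R) (dset R I).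
Proof. exact: measurable_itv. Qed.
Hint Resolve measurable_dset : core.

Lemma dset_halves I : dset R (right_half I) `|` dset R (left_half I) = dset R I.
Proof.
have p0 : 0 < (2 : R) ^ (- I.1) by rewrite exprz_gt0.
rewrite /dset /right_half /left_half /= opprD expfzDr// exprN1.
set p := 2 ^ _ in p0 *; set k := I.2.
rewrite !intrD !intrM.
apply/seteqP; split => x /=; rewrite !in_itv/=.
  by case=> /andP[h1 h2]; apply/andP; lra.
move=> /andP[h1 h2].
case: (ltP x ((2 * k%:~R + 1) * (p / 2))) => h; [right|left]; apply/andP; lra.
Qed.

Lemma dset_halves_disj I : [disjoint dset R (right_half I) & dset R (left_half I)].
Proof.
apply/disj_setPS => x [] /=; rewrite /dset /= !in_itv/= => /andP[h1 h2] /andP[h3 h4].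
by have := lt_le_trans h4 h1; rewrite ltxx.
Qed.

Definition dyadic_integrable f : Prop :=
  forall I, mu.-integrable (dset R I) (EFin \o f).

Lemma mean_Rintegral f I : dyadic_integrable f ->
  mean I f = (dlen R I)^-1 * \int[mu]_(x in dset R I) f x.
Proof.
move=> fi; rewrite /mean /emean fineM//.
exact: (integrable_fin_num (measurable_dset I) (fi I)).
Qed.

Lemma Rintegral_dset f I : dyadic_integrable f ->
  \int[mu]_(x in dset R I) f x = dlen R I * mean I f.
Proof.
by move=> fi; rewrite mean_Rintegral// mulrA divff ?mul1r// gt_eqF ?dlen_gt0.
Qed.

Lemma emean_fin f I : dyadic_integrable f -> emean I f = (mean I f)%:E.
Proof.
move=> fi; rewrite /mean fineK// /emean fin_numM//.
exact: (integrable_fin_num (measurable_dset I) (fi I)).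
Qed.

Lemma mean_avg f : dyadic_integrable f -> dyadic_avg (fun I => mean I f).
Proof.
move=> fi I; rewrite [LHS]mean_Rintegral// -dset_halves Rintegral_setU//.
- rewrite !Rintegral_dset// dlen_left_half dlen_right_half.
  by field; rewrite gt_eqF ?dlen_gt0.
- by rewrite dset_halves.
- exact: dset_halves_disj.
Qed.

Lemma locally_integrable_dyadic f :
  locally_integrable [set: R] f -> dyadic_integrable f.
Proof.
move=> [mf _ fi] I; apply/integrableP; split.
  by apply/measurable_EFinP; apply: measurable_funS mf.
pose a := I.2%:~R * (2 : R) ^ (- I.1); pose b := (I.2 + 1)%:~R * (2 : R) ^ (- I.1).
have := fi `[a, b]%classic; move=> /(_ _ (@segment_compact _ a b)) => H.
apply: le_lt_trans (H _) => //.
apply: ge0_subset_integral; [exact: measurable_itv|exact: measurable_itv| |by []|].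
- apply/measurable_EFinP; apply: measurableT_comp => //.
  exact: measurable_funS mf.
- by apply: subset_itvl; rewrite bnd_simp.
Qed.

(** Reduces weights that are positive only almost everywhere to nonnegative
    integrands. *)
Lemma mean_abs f I : dyadic_integrable f -> {ae mu, forall x, 0 <= f x} ->
  mean I f = mean I (fun x => `|f x|).
Proof.
move=> fi f0; rewrite /mean /emean; congr (fine (_ * _))%E.
have mfe : measurable_fun (dset R I) (EFin \o f) by exact: measurable_int (fi I).
apply: ae_eq_integral => //.
  by apply/measurable_EFinP; apply: measurableT_comp => //; exact/measurable_EFinP.
by apply: (@filterS _ _ (ae_filter_ringOfSetsType mu)) f0 => x x0 _ /=; rewrite ger0_norm.
Qed.

Lemma mean_gt0 f I : measurable_fun [set: R] f -> dyadic_integrable f ->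
  {ae mu, forall x, 0 < f x} -> 0 < mean I f.
Proof.
move=> mf fi f0.
have mfe : measurable_fun (dset R I) (EFin \o f) by exact: measurable_int (fi I).
rewrite mean_abs//; last first.
  by apply: (@filterS _ _ (ae_filter_ringOfSetsType mu)) f0 => x /ltW.
have fin : (\int[mu]_(x in dset R I) `|f x|%:E)%E \is a fin_num.
  have /integrableP[_] := fi I.
  by move=> h; rewrite ge0_fin_numE// integral_ge0.
rewrite /mean /emean fineM// mulr_gt0 ?invr_gt0 ?dlen_gt0//.
rewrite lt_neqAle fine_ge0 ?andbT; last by apply: integral_ge0 => x _; rewrite lee_fin.
apply/negP => /eqP f00.
have : (\int[mu]_(x in dset R I) `|(EFin \o f) x| = 0)%E.
  by rewrite -[LHS]fineK// -f00.
move=> /ae_eq_integral_abs -/(_ (measurable_dset I) mfe) fz.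
have [N [mN N0 NI]] : {ae mu, forall x, ~ dset R I x}.
  by apply: (@filterS2 _ _ (ae_filter_ringOfSetsType mu)) fz f0
    => x fx x0 /fx [fx0]; move: x0; rewrite fx0 ltxx.
have : (mu (dset R I) <= mu N)%E.
  by apply: le_measure; rewrite ?inE// => x Ix; apply: NI => /(_ Ix).
rewrite N0 leNgt => /negP; apply.
have := dlen_gt0 R I; rewrite /dlen.
by case: (mu (dset R I)) => [r| |]; rewrite /= ?ltxx// lte_fin.
Qed.


Lemma dyadic_integrableD f g : dyadic_integrable f -> dyadic_integrable g ->
  dyadic_integrable (fun x => f x + g x).
Proof.
move=> fi gi I; have := integrableD (measurable_dset I) (fi I) (gi I).
by apply: eq_integrable => // x _; rewrite /= EFinD.
Qed.

Lemma dyadic_integrableZ c f : dyadic_integrable f ->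
  dyadic_integrable (fun x => c * f x).
Proof.
move=> fi I; have := integrableZl (measurable_dset I) c (fi I).
by apply: eq_integrable.
Qed.

Lemma dyadic_integrable_cst c : dyadic_integrable (fun=> c).
Proof.
move=> I; apply: locally_integrable_dyadic; split => //; first exact: openT.
move=> K _ cK; rewrite integral_cst/=; last exact: compact_measurable.
by rewrite lte_mul_pinfty// ?lte_fin//; exact: compact_finite_measure.
Qed.

Lemma dyadic_integrable_le f g : measurable_fun [set: R] f ->
  dyadic_integrable g -> (forall x, `|f x| <= g x) -> dyadic_integrable f.
Proof.
move=> mf gi fg I; apply: (le_integrable (measurable_dset I) _ _ (gi I)).
  by apply/measurable_EFinP; apply: measurable_funS mf.
by move=> x _ /=; rewrite lee_fin (le_trans (fg x))// ler_norm.
Qed.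

Lemma meanD f g I : dyadic_integrable f -> dyadic_integrable g ->
  mean I (fun x => f x + g x) = mean I f + mean I g.
Proof.
move=> fi gi; have fgi := dyadic_integrableD fi gi.
by rewrite !mean_Rintegral// RintegralD// mulrDr.
Qed.

Lemma meanZ c f I : dyadic_integrable f ->
  mean I (fun x => c * f x) = c * mean I f.
Proof.
move=> fi; have cfi := dyadic_integrableZ c fi.
rewrite mean_Rintegral// [mean I f]mean_Rintegral//.
by rewrite (RintegralZl c (measurable_dset I) (fi I)) mulrCA.
Qed.

Lemma mean_cst (c : R) I : mean I (fun=> c) = c.
Proof.
rewrite mean_Rintegral; last exact: dyadic_integrable_cst.
rewrite Rintegral_cst; last exact: measurable_dset.
by rewrite mulrCA mulVf ?mulr1// gt_eqF// dlen_gt0.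
Qed.

Lemma le_mean f g I : dyadic_integrable f -> dyadic_integrable g ->
  {ae mu, forall x, f x <= g x} -> mean I f <= mean I g.
Proof.
move=> fi gi fg.
have hi : dyadic_integrable (fun x => g x + -1 * f x).
  by apply: dyadic_integrableD => //; exact: dyadic_integrableZ.
have : 0 <= mean I (fun x => g x + -1 * f x).
  rewrite mean_abs//; last first.
    apply: (@filterS _ _ (ae_filter_ringOfSetsType mu)) fg => x fg.
    by rewrite mulN1r subr_ge0.
  rewrite /mean fine_ge0// mule_ge0 ?lee_fin ?invr_ge0 ?(ltW (dlen_gt0 _ _))//.
  by apply: integral_ge0 => x _; rewrite lee_fin.
rewrite meanD//; last exact: dyadic_integrableZ.
by rewrite meanZ// mulN1r subr_ge0.
Qed.

(** The pointwise inequality [(g - l h) ^ 2 >= 0] is integrated with the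
    optimal constant [l]. *)
Lemma mean_cauchy_schwarz g h v I : dyadic_integrable (fun x => g x ^+ 2) ->
  dyadic_integrable (fun x => g x * h x) -> dyadic_integrable v ->
  (forall x, h x ^+ 2 = v x) -> 0 < mean I v ->
  mean I (fun x => g x * h x) ^+ 2 <= mean I (fun x => g x ^+ 2) * mean I v.
Proof.
move=> g2i ghi vi hv v0.
set X := mean I (fun x => g x ^+ 2); set Y := mean I _; set V := mean I v in v0 *.
pose l := Y / V.
have : 2 * l * Y + - l ^+ 2 * V <= X.
  rewrite -!meanZ// -meanD; [|exact: dyadic_integrableZ..].
  apply: le_mean => //.
    by apply: dyadic_integrableD; exact: dyadic_integrableZ.
  apply: aeW => x; rewrite -hv -subr_ge0.
  have -> : g x ^+ 2 - (2 * l * (g x * h x) + - l ^+ 2 * h x ^+ 2)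
    = (g x - l * h x) ^+ 2 by ring.
  exact: sqr_ge0.
have -> : 2 * l * Y + - l ^+ 2 * V = Y ^+ 2 / V.
  by rewrite /l; field; rewrite gt_eqF.
by rewrite ler_pdivrMr.
Qed.

(** Jensen's inequality for the convex function [r ^ (- 1 / p)], through its
    tangent at the mean of v. *)
Lemma Ad_lower_bound p v I : 0 < p -> dyadic_integrable v ->
  dyadic_integrable (wpow v (- p^-1)) -> {ae mu, forall x, 0 < v x} ->
  0 < mean I v ->
  1 <= mean I v * mean I (wpow v (- p^-1)) `^ p.
Proof.
move=> p0 vi ui vpos V0.
set V := mean I v in V0 *; set U := mean I _.
pose c := V `^ (- p^-1).
have c0 : 0 < c by exact: powR_gt0.
(* v ^ (- 1 / p) lies above its tangent at V where v > 0. *)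
have cU : c <= U.
  have : mean I (fun=> c * (1 + p^-1)) <=
      mean I (fun x => wpow v (- p^-1) x + c * p^-1 / V * v x).
    apply: le_mean; first exact: dyadic_integrable_cst.
      by apply: dyadic_integrableD => //; exact: dyadic_integrableZ.
    apply: (@filterS _ _ (ae_filter_ringOfSetsType mu)) vpos => x vx.
    pose r := v x / V.
    have r0 : 0 < r by rewrite divr_gt0.
    have -> : v x = V * r by rewrite /r; field; rewrite gt_eqF.
    have -> : wpow v (- p^-1) x = c * r `^ (- p^-1).
      rewrite /wpow /c -powRM ?(ltW V0) ?(ltW r0)//.
      by congr (_ `^ _); rewrite /r; field; rewrite gt_eqF.
    have -> : c * p^-1 / V * (V * r) = c * (p^-1 * r) by field; rewrite !gt_eqF.
    rewrite -mulrDr ler_pM2l// /powR (gt_eqF r0).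
    have E := expR_ge1Dx (- p^-1 * ln r).
    have L : p^-1 * ln r <= p^-1 * (r - 1).
      rewrite ler_pM2l ?invr_gt0//.
      have := @le_ln1Dx R (r - 1).
      have -> : 1 + (r - 1) = r by ring.
      by apply; rewrite ltrBrDr addNr.
    lra.
  rewrite mean_cst meanD//; last exact: dyadic_integrableZ.
  rewrite meanZ// -/V -/U.
  have -> : c * p^-1 / V * V = c * p^-1 by field; rewrite !gt_eqF.
  lra.
have -> : 1 = V * c `^ p.
  rewrite /c -powRrM mulNr mulVf ?gt_eqF// powR_inv1 ?(ltW V0)//.
  by rewrite mulfV// gt_eqF.
rewrite (ler_pM2l V0); apply: (ge0_ler_powR (ltW p0) _ _ cU); rewrite nnegrE.
  exact: (ltW c0).
exact: (le_trans (ltW c0) cU).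
Qed.

Lemma inner_haar f I : dyadic_integrable f ->
  inner f (haar I) = Num.sqrt (dlen R I) *
    ((mean (right_half I) f - mean (left_half I) f) / 2).
Proof.
move=> fi.
have s0 : 0 < Num.sqrt (dlen R I) by rewrite sqrtr_gt0 dlen_gt0.
have s2 : Num.sqrt (dlen R I) ^+ 2 = dlen R I by rewrite sqr_sqrtr// ltW// dlen_gt0.
have fiT J : mu.-integrable setT (EFin \o (f \* \1_(dset R J))).
  rewrite -patch_indic; have /(integrable_mkcond _ (measurable_dset J)) := fi J.
  by rewrite restrict_EFin.
have fE J : \int[mu]_x (f \* \1_(dset R J)) x = dlen R J * mean J f.
  by rewrite -patch_indic -Rintegral_mkcond Rintegral_dset.
rewrite /inner.
transitivity (\int[mu]_x ((Num.sqrt (dlen R I))^-1 *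
   ((f \* \1_(dset R (right_half I))) x - (f \* \1_(dset R (left_half I))) x))).
  by apply: eq_Rintegral => x _; rewrite /haar /=; ring.
rewrite RintegralZl//; last first.
  have := integrableB measurableT (fiT (right_half I)) (fiT (left_half I)).
  by apply: eq_integrable.
rewrite RintegralB// !fE dlen_left_half dlen_right_half.
move: s0 s2; set s := Num.sqrt _ => s0 <-.
by field; rewrite gt_eqF.
Qed.

End dyadic_integrals.

(** * The weighted square function *)

Definition L2sq (R : realType) (g : R -> R) : R :=
  \int[@lebesgue_measure R]_x (g x ^+ 2).

Lemma Lfun2_measurable (R : realType) (g : R -> R) :
  g \in Lfun (@lebesgue_measure R) 2%:E -> measurable_fun [set: R] g.
Proof. by rewrite inE => /andP[]; rewrite inE. Qed.

Lemma Lnorm2E (R : realType) (g : R -> R) : g \in Lfun (@lebesgue_measure R) 2%:E ->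
  ('N[@lebesgue_measure R]_(2%:E)[EFin \o g] = (Num.sqrt (L2sq g))%:E)%E.
Proof.
move=> gL; have g2 := Lfun2_integrable_sqr gL.
have E : (\int[@lebesgue_measure R]_x (g x ^+ 2)%:E = (L2sq g)%:E)%E.
  by rewrite /L2sq /Rintegral fineK//; exact: (integrable_fin_num measurableT g2).
rewrite unlock.
have -> : (\int[@lebesgue_measure R]_x `|(EFin \o g) x| `^ 2 = (L2sq g)%:E)%E.
  rewrite -E; apply: eq_integral => x _ /=.
  by rewrite powR_mulrn// real_normK// num_real.
rewrite poweR_EFin powR12_sqrt// /L2sq; apply: Rintegral_ge0 => x _; exact: sqr_ge0.
Qed.

Lemma L2sq_ge0 (R : realType) (g : R -> R) : 0 <= L2sq g.
Proof. by apply: Rintegral_ge0 => x _; exact: sqr_ge0. Qed.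

Lemma Lfun2_sqr_dyadic_integrable (R : realType) (g : R -> R) :
  g \in Lfun (@lebesgue_measure R) 2%:E ->
  dyadic_integrable (fun x => g x ^+ 2).
Proof.
move=> gL I; have := Lfun2_integrable_sqr gL.
by apply: integrableS => //; exact: measurable_dset.
Qed.

Lemma mean_sqr_le_L2sq (R : realType) (g : R -> R) (K : int) :
  g \in Lfun (@lebesgue_measure R) 2%:E ->
  dlen R (K, 0) * mean (K, 0) (fun x => g x ^+ 2) +
  dlen R (K, -1) * mean (K, -1) (fun x => g x ^+ 2) <= L2sq g.
Proof.
move=> gL; have gi := Lfun2_sqr_dyadic_integrable gL.
have p0 : 0 < (2 : R) ^ (- K) by rewrite exprz_gt0.
have iU : (@lebesgue_measure R).-integrable (dset R (K, 0) `|` dset R (K, -1))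
    (EFin \o (fun x => g x ^+ 2)).
  apply: (integrableS measurableT _ _ (Lfun2_integrable_sqr gL)) => //.
  by apply: measurableU; exact: measurable_dset.
rewrite -!Rintegral_dset// -Rintegral_setU//; last 3 first.
- exact: measurable_dset.
- exact: measurable_dset.
- apply/disj_setPS => x [] /=; rewrite /dset /= !in_itv/= => /andP[h1 h2] /andP[h3 h4].
  by have := lt_le_trans h4 h1; rewrite ltxx.
rewrite /L2sq /Rintegral fine_le//.
- by apply: (integrable_fin_num _ iU); apply: measurableU; exact: measurable_dset.
- exact: (integrable_fin_num measurableT (Lfun2_integrable_sqr gL)).
- apply: ge0_subset_integral => //.
  + by apply: measurableU; exact: measurable_dset.
  + exact: measurable_int (Lfun2_integrable_sqr gL).
  + by move=> x _; rewrite lee_fin sqr_ge0.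
Qed.

Lemma measurable_wpow (R : realType) (w : R -> R) (s : R) :
  measurable_fun [set: R] w -> measurable_fun [set: R] (wpow w s).
Proof. by move=> mw; apply: (measurableT_comp (measurable_powR s) mw). Qed.

Lemma wpow_ae_gt0 (R : realType) (w : R -> R) (s : R) :
  {ae @lebesgue_measure R, forall x, 0 < w x} ->
  {ae @lebesgue_measure R, forall x, 0 < wpow w s x}.
Proof.
apply: (@filterS _ _ (ae_filter_ringOfSetsType (@lebesgue_measure R))) => x.
exact: powR_gt0.
Qed.

(** The weighted square function estimate, with linear dependence on the
    A_q characteristic; h stands for the square root of v. *)
Lemma haar_square_sum (R : realType) (p Q : R) (v h g : R -> R) (A : seq dyadic) :
  0 < p -> measurable_fun [set: R] v -> dyadic_integrable v ->
  {ae @lebesgue_measure R, forall x, 0 < v x} ->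
  dyadic_integrable (wpow v (- p^-1)) ->
  (forall I, mean I v * mean I (wpow v (- p^-1)) `^ p <= Q) ->
  measurable_fun [set: R] h -> (forall x, h x ^+ 2 = v x) ->
  g \in Lfun (@lebesgue_measure R) 2%:E -> uniq A ->
  dyadic_integrable (fun x => g x * h x) /\
  \sum_(J <- A) inner (fun x => g x * h x) (haar J) ^+ 2 / mean J v
    <= (2 + 2304 * Q) * L2sq g.
Proof.
move=> p0 mv vi v0 ui vuQ mh hv gL uA.
have g2i := Lfun2_sqr_dyadic_integrable gL.
have V0 I : 0 < mean I v by exact: mean_gt0.
have U0 I : 0 < mean I (wpow v (- p^-1)).
  by apply: mean_gt0 => //; [exact: measurable_wpow|exact: wpow_ae_gt0].
have ghi : dyadic_integrable (fun x => g x * h x).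
  apply: (@dyadic_integrable_le _ _ (fun x => g x ^+ 2 + v x)).
  - by apply: measurable_funM => //; exact: Lfun2_measurable.
  - exact: dyadic_integrableD.
  - move=> x; rewrite -hv ler_norml.
    have := sqr_ge0 (g x + h x); have := sqr_ge0 (g x - h x).
    have := sqr_ge0 (g x); have := sqr_ge0 (h x).
    by set a := g x; set b := h x => ? ? ? ?; apply/andP; lra.
split=> //.
have vu I : 1 <= mean I v * mean I (wpow v (- p^-1)) `^ p <= Q.
  by rewrite vuQ andbT; exact: Ad_lower_bound.
have := @square_sum_le _ p Q _ _ _ _ p0 (mean_avg g2i) (mean_avg ghi) (mean_avg vi)
  (mean_avg ui) V0 U0 vu (fun I => mean_cauchy_schwarz g2i ghi vi hv (V0 I))
  (L2sq g) A uA (fun K => mean_sqr_le_L2sq K gL).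
apply: le_trans; rewrite le_eqVlt; apply/orP; left; apply/eqP.
apply: eq_bigr => J _; rewrite inner_haar// /square_term exprMn.
by rewrite sqr_sqrtr ?(ltW (dlen_gt0 _ _))// mulrA.
Qed.

(** The square function estimate for the weight 1. *)
Lemma haar_bessel (R : realType) (f : R -> R) (A : seq dyadic) :
  f \in Lfun (@lebesgue_measure R) 2%:E -> uniq A ->
  \sum_(J <- A) inner f (haar J) ^+ 2 <= 2306 * L2sq f.
Proof.
move=> fL uA.
have one : wpow (fun=> 1 : R) (- 1^-1) = fun=> 1.
  by apply/funext => x; rewrite /wpow powR1.
have c1 := @dyadic_integrable_cst R 1.
have [] := @haar_square_sum R 1 1 (fun=> 1) (fun=> 1) f A ltr01.
- exact: measurable_cst.
- exact: c1.
- by apply: aeW => x; exact: ltr01.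
- by rewrite one.
- by move=> I; rewrite one mean_cst powR1 mulr1.
- exact: measurable_cst.
- by move=> x; rewrite expr1n.
- exact: fL.
- exact: uA.
move=> _; have -> : 2 + 2304 * 1 = 2306 :> R by ring.
apply: le_trans; rewrite le_eqVlt; apply/orP; left; apply/eqP.
apply: eq_bigr => J _; rewrite mean_cst divr1.
by congr (inner _ _ ^+ 2); apply/funext => x; rewrite mulr1.
Qed.

(** * Descendants of a given generation *)

(** For [i < 2 ^ m], the dyadic intervals of generation m below L, numbered
    from left to right. *)
Definition child (m : nat) (L : dyadic) (i : nat) : dyadic :=
  (L.1 + m%:Z, L.2 * (2 ^ m)%N%:Z + i%:Z).

Lemma child_inj (m : nat) (L L' : dyadic) (i i' : nat) :
  (i < 2 ^ m)%N -> (i' < 2 ^ m)%N -> child m L i = child m L' i' ->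
  L = L' /\ i = i'.
Proof.
case: L L' => [j k] [j' k']; rewrite /child /= => im im' [/addIr -> E].
have kk : k = k'.
  have := divzMDl k i%:Z; have := divzMDl k' i'%:Z.
  have m0 : (2 ^ m)%N%:Z != 0 by rewrite eqz_nat -lt0n expn_gt0.
  move=> /(_ _ m0) h1 /(_ _ m0); rewrite E h1 !divz_small ?addr0// => /esym//.
by move: E; rewrite kk => /addrI [->].
Qed.

Lemma sum_child (R : realType) (x : dyadic -> R) (n : nat) (L : dyadic) :
  dyadic_avg x -> \sum_(j < 2 ^ n) x (child n L j) = (2 ^ n)%:R * x L.
Proof.
move=> xavg; elim: n L => [|n IH] L.
  by rewrite expn0 big_ord1 mul1r /child /= addr0 mulr1 addr0; case: L.
rewrite expnS mul2n -addnn big_split_ord /=.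
have -> : \sum_(i < 2 ^ n) x (child n.+1 L i) = (2 ^ n)%:R * x (left_half L).
  rewrite -IH; apply: eq_bigr => i _; congr (x _).
  by rewrite /child /left_half /= expnS; congr (_, _); lia.
have -> : \sum_(i < 2 ^ n) x (child n.+1 L (2 ^ n + i)%N) = (2 ^ n)%:R * x (right_half L).
  rewrite -IH; apply: eq_bigr => i _; congr (x _).
  by rewrite /child /right_half /= expnS; congr (_, _); lia.
by rewrite (xavg L) natrD; field.
Qed.

Lemma dlen_child (R : realType) (m : nat) (L : dyadic) (i : nat) :
  (2 ^ m)%:R * dlen R (child m L i) = dlen R L.
Proof.
by rewrite !dlenE /= opprD expfzDr// natrX -exprnN mulrCA divff ?mulr1// expf_neq0.
Qed.

Lemma descendant_child (R : realType) (m : nat) (L I : dyadic) :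
  descendants R m L I -> exists2 i : nat, (i < 2 ^ m)%N & I = child m L i.
Proof.
case: L I => [j k] [j' k'] [sub len].
have jj : j' = j + m%:Z.
  move: len; rewrite !dlenE /= exprnN -expfzDr//.
  have n1 : (2 : R) != 1 by rewrite gt_eqF// ltr1n.
  by move=> /(ieexprIz (ltr0n _ 2) n1); lia.
have p0 : 0 < (2 : R) ^ (- j') by rewrite exprz_gt0.
have pE : (2 : R) ^ (- j) = (2 ^ m)%N%:Z%:~R * 2 ^ (- j').
  rewrite jj opprD expfzDr// -pmulrn natrX -exprnN mulrCA divff ?mulr1//.
have : dset R (j, k) (k'%:~R * 2 ^ (- j')).
  by apply: sub; rewrite /dset /= in_itv /= lexx ltr_pM2r// ltr_int ltrDl.
rewrite /dset /= in_itv /= pE !mulrA -!intrM => /andP[].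
rewrite ler_pM2r// ltr_pM2r// ler_int ltr_int => h1 h2.
exists (absz (k' - k * (2 ^ m)%N%:Z)%R); first by lia.
by rewrite /child /= jj; congr (_, _); lia.
Qed.

(** * The bilinear form *)

(** The inequality between the geometric and arithmetic means, without the
    square roots that the terms of the form would require. *)
Lemma norm_le_of_sqr (R : realFieldType) (X A B c : R) : 0 <= A -> 0 <= B ->
  0 <= c -> X ^+ 2 <= c ^+ 2 * (A * B) -> `|X| <= c * ((A + B) / 2).
Proof.
move=> A0 B0 c0 XAB.
have AB0 : 0 <= (A + B) / 2 by lra.
rewrite -(@ler_pXn2r _ 2) // ?nnegrE; last exact: mulr_ge0.
rewrite real_normK ?num_real//.
apply: (le_trans XAB); rewrite exprMn ler_wpM2l ?sqr_ge0//.
have := sqr_ge0 (A - B); nra.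
Qed.

(** The optimal choice is [e = b / a]; shifting a and b by a small [r > 0]
    covers the cases a = 0 and b = 0. *)
Lemma le_of_amgm (R : realFieldType) (S K a b : R) : 0 <= K -> 0 <= a -> 0 <= b ->
  (forall e, 0 < e -> S <= K * ((e * a ^+ 2 + e^-1 * b ^+ 2) / 2)) ->
  S <= K * (a * b).
Proof.
move=> K0 a0 b0 H; apply/ler_addgt0Pr => d d0.
(* Shifting a and b by r costs at most K r (a + b + 1) <= d. *)
pose r := Num.min 1 (d / (1 + K * (a + b + 1))).
have KK : 0 < 1 + K * (a + b + 1).
  by rewrite ltr_pwDl// mulr_ge0//; lra.
have r0 : 0 < r by rewrite lt_min ltr01 divr_gt0.
have r1 : r <= 1 by rewrite ge_min lexx.
have rd : r * (1 + K * (a + b + 1)) <= d by rewrite -ler_pdivlMr// ge_min lexx orbT.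
have ar : 0 < a + r by lra.
have br : 0 < b + r by lra.
have := H ((b + r) / (a + r)) (divr_gt0 br ar); rewrite invf_div => /le_trans; apply.
have h1 : (b + r) / (a + r) * a ^+ 2 <= (b + r) * (a + r).
  rewrite -mulrA ler_pM2l// mulrC ler_pdivrMr// -expr2.
  by rewrite ler_pXn2r// ?nnegrE; lra.
have h2 : (a + r) / (b + r) * b ^+ 2 <= (b + r) * (a + r).
  rewrite mulrC mulrA mulrC ler_pdivrMl//.
  rewrite mulrA -expr2 ler_pM2r// ler_pXn2r// ?nnegrE; lra.
apply: (@le_trans _ _ (K * ((b + r) * (a + r)))).
  by rewrite ler_wpM2l//; lra.
have -> : (b + r) * (a + r) = a * b + r * (a + b + r) by ring.
rewrite mulrDr lerD2l; apply: le_trans rd.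
rewrite mulrCA ler_pM2l//.
have : K * (a + b + r) <= K * (a + b + 1) by rewrite ler_wpM2l//; lra.
lra.
Qed.

(** The weights are the fractions of the mass of L carried by its
    descendants of generation n. *)
Lemma sum_child_weights (R : realType) (v : dyadic -> R) (n : nat) (L : dyadic) (c : R) :
  dyadic_avg v -> (forall I, 0 < v I) ->
  \sum_(j < 2 ^ n) c * (dlen R (child n L j) * v (child n L j) / (dlen R L * v L)) = c.
Proof.
move=> vavg v0; rewrite -mulr_sumr -mulr_suml.
have n0 : 0 < (2 ^ n)%:R :> R by rewrite ltr0n expn_gt0.
have E (j : nat) : dlen R (child n L j) = dlen R L / (2 ^ n)%:R.
  by rewrite -(dlen_child R n L j); field; rewrite gt_eqF.
under eq_bigr do rewrite E.
rewrite -mulr_sumr sum_child//.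
by field; rewrite !gt_eqF// ?dlen_gt0.
Qed.

Lemma sum_child_len (R : realType) (m : nat) (L : dyadic) (c : R) :
  \sum_(i < 2 ^ m) c * (dlen R (child m L i) / dlen R L) = c.
Proof.
have H := @sum_child_weights R (fun=> 1) m L c.
rewrite -[RHS]H//; last by move=> I; field.
by apply: eq_bigr => i _; rewrite !mulr1.
Qed.

(** A dyadic interval is a descendant of generation n of exactly one L, so
    the double sum has no repetition. *)
Lemma sum_children_le (R : realType) (a : dyadic -> R) (M : R) (n : nat) (Ls : seq dyadic) :
  uniq Ls -> (forall A : seq dyadic, uniq A -> \sum_(J <- A) a J <= M) ->
  \sum_(L <- Ls) \sum_(i < 2 ^ n) a (child n L i) <= M.
Proof.
move=> uL aM.
pose A := [seq child n L (nat_of_ord i) | L <- Ls, i <- enum 'I_(2 ^ n)].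
have uA : uniq A.
  apply: allpairs_uniq => //; first exact: enum_uniq.
  move=> [L i] [L' i'] _ _ /= /(child_inj (ltn_ord i) (ltn_ord i'))[-> /val_inj ->] //.
have := aM A uA; rewrite big_allpairs_dep /=; apply: le_trans.
rewrite le_eqVlt; apply/orP; left; apply/eqP.
by apply: eq_bigr => L _; rewrite big_enum.
Qed.

Section form_bound.
Variables (R : realType) (t : R) (m n : nat) (w f g : R -> R) (Q c : R).
Let v := wpow w (2 * t).
Let G := fun x => g x * wpow w t x.
Hypotheses (c_ge0 : 0 <= c) (v_avg : dyadic_avg (fun I => mean I v))
  (v_gt0 : forall I, 0 < mean I v)
  (wv : forall I, (mean I w `^ (- t)) ^+ 2 * mean I v <= c ^+ 2).
Variables (MF MG : R).
Hypotheses
  (F_le : forall A, uniq A -> \sum_(J <- A) inner f (haar J) ^+ 2 <= MF)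
  (G_le : forall A, uniq A -> \sum_(J <- A) inner G (haar J) ^+ 2 / mean J v <= MG).

(** The two summands carry the weights that add up to 1 over J and over I
    respectively. *)
Lemma form_term_le e L I J : 0 < e ->
  `|form_term t w f g (L, I, J)| <=
  c * ((e * inner f (haar I) ^+ 2 * (dlen R J * mean J v / (dlen R L * mean L v)) +
        e^-1 * (inner G (haar J) ^+ 2 / mean J v) * (dlen R I / dlen R L)) / 2).
Proof.
move=> e0; rewrite /form_term /=.
have -> : inner (fun x => wpow w t x * haar J x) g = inner G (haar J).
  by apply: eq_Rintegral => x _; rewrite /G; ring.
set F := inner f _; set H := inner G _.
have [[I0 J0] L0] := (dlen_gt0 R I, dlen_gt0 R J, dlen_gt0 R L).
have [vJ vL] := (v_gt0 J, v_gt0 L).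
apply: norm_le_of_sqr => //.
- by do ?[exact: sqr_ge0|rewrite invr_ge0|exact: ltW|apply: mulr_ge0].
- by do ?[exact: sqr_ge0|rewrite invr_ge0|exact: ltW|apply: mulr_ge0].
rewrite !exprMn sqr_sqrtr; last by rewrite mulr_ge0// ltW.
set W := (mean L w `^ (- t)) ^+ 2.
have WL : W <= c ^+ 2 / mean L v by rewrite ler_pdivlMr//; exact: wv.
have K0 : 0 <= dlen R I * dlen R J * (dlen R L)^-1 ^+ 2 * F ^+ 2 * H ^+ 2.
  by do ?[exact: sqr_ge0|rewrite invr_ge0|exact: ltW|apply: mulr_ge0].
apply: (@le_trans _ _ (dlen R I * dlen R J * (dlen R L)^-1 ^+ 2 * F ^+ 2 * H ^+ 2 *
   (c ^+ 2 / mean L v))).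
  apply: le_trans (ler_wpM2l K0 WL).
  by rewrite le_eqVlt; apply/orP; left; apply/eqP; ring.
rewrite le_eqVlt; apply/orP; left; apply/eqP; field.
by rewrite !gt_eqF.
Qed.

(** The index set embeds in the product of the L, the I and the J; the sum
    over J of the first summand of [form_term_le] and the sum over I of the
    second collapse before [F_le] and [G_le] are applied. *)
Lemma form_sum_le e (A : seq (dyadic * dyadic * dyadic)) : 0 < e -> uniq A ->
  (forall LIJ, LIJ \in A -> form_index R m n LIJ) ->
  \sum_(LIJ <- A) `|form_term t w f g LIJ| <= c * ((e * MF + e^-1 * MG) / 2).
Proof.
move=> e0 uA AD.
pose Ls := undup [seq LIJ.1.1 | LIJ <- A].
have uL : uniq Ls := undup_uniq _.
pose S := flatten [seq [seq (L, child m L (nat_of_ord i), child n L (nat_of_ord j)) |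
  i <- enum 'I_(2 ^ m), j <- enum 'I_(2 ^ n)] | L <- Ls].
have AS : {subset A <= S}.
  move=> [[L I] J] LIJ; have [] := AD _ LIJ => /=.
  move=> /descendant_child[i im ->] /descendant_child[j jn ->].
  apply/flatten_mapP; exists L.
    by rewrite mem_undup; apply/mapP; exists (L, I, J).
  by apply/allpairsP; exists (Ordinal im, Ordinal jn); rewrite !mem_enum.
apply: (le_trans (ler_sum_subset (fun _ => normr_ge0 _) uA AS)).
rewrite big_flatten big_map /=.
pose a L i := inner f (haar (child m L i)) ^+ 2.
pose b L j := inner G (haar (child n L j)) ^+ 2 / mean (child n L j) v.
apply: (@le_trans _ _ (\sum_(L <- Ls) c * ((e * \sum_(i < 2 ^ m) a L i +
   e^-1 * \sum_(j < 2 ^ n) b L j) / 2))).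
  apply: ler_sum => L _; rewrite big_allpairs_dep /= big_enum /=.
  pose T i j := e * a L i * (dlen R (child n L j) * mean (child n L j) v /
        (dlen R L * mean L v)) + e^-1 * b L j * (dlen R (child m L i) / dlen R L).
  have -> : c * ((e * \sum_(i < 2 ^ m) a L i + e^-1 * \sum_(j < 2 ^ n) b L j) / 2)
    = \sum_(i < 2 ^ m) \sum_(j < 2 ^ n) c * (T i j / 2).
    under [RHS]eq_bigr do rewrite -mulr_sumr -mulr_suml.
    rewrite -mulr_sumr -mulr_suml; congr (_ * (_ / _)).
    have W i : \sum_(j < 2 ^ n) T i j = e * a L i + \sum_(j < 2 ^ n)
        e^-1 * b L j * (dlen R (child m L i) / dlen R L).
      rewrite /T big_split /=; congr (_ + _).
      exact: (sum_child_weights n L _ v_avg v_gt0).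
    under [RHS]eq_bigr do rewrite W.
    rewrite big_split /= mulr_sumr; congr (_ + _).
    rewrite exchange_big mulr_sumr; apply: eq_bigr => j _.
    by rewrite sum_child_len.
  apply: ler_sum => i _; rewrite big_enum /=; apply: ler_sum => j _.
  exact: form_term_le.
rewrite -mulr_sumr ler_wpM2l// -mulr_suml ler_pM2r//.
rewrite big_split /= -!mulr_sumr; apply: lerD.
  rewrite ler_pM2l//.
  exact: (sum_children_le (a := fun I => inner f (haar I) ^+ 2) m uL F_le).
rewrite ler_pM2l ?invr_gt0//.
exact: (sum_children_le (a := fun J => inner G (haar J) ^+ 2 / mean J v) n uL G_le).
Qed.

End form_bound.

(** * Characteristics and the norm bound *)

Lemma wpow_sqr (R : realType) (w : R -> R) (t x : R) :
  wpow w t x ^+ 2 = wpow w (2 * t) x.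
Proof.
rewrite /wpow /powR; case: eqP => _.
  by rewrite mulf_eq0 pnatr_eq0 /=; case: eqP => _; rewrite ?expr1n ?expr0n.
by rewrite expr2 -expRD; congr expR; ring.
Qed.

(** The A_q condition is stated with extended means; as the mean of v is
    positive, an infinite mean of the dual weight would make the
    characteristic infinite. *)
Lemma Ad_char_dual_integrable (R : realType) (q : R) (v : R -> R) :
  1 < q -> Ad_class q v -> dyadic_integrable (wpow v (- (q - 1)^-1)).
Proof.
move=> q1 [[vloc v0] vq] I.
have vi := locally_integrable_dyadic vloc.
have mv : measurable_fun [set: R] v by case: vloc.
set u := wpow v _.
have mu : measurable_fun [set: R] u by exact: measurable_wpow.
have u0 x : 0 <= u x by exact: powR_ge0.
apply/integrableP; split.
  by apply/measurable_EFinP; apply: measurable_funS mu.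
under eq_integral do rewrite /= ger0_norm//.
rewrite ltey; apply/eqP => uoo.
have := vq; rewrite ltNge => /negP; apply.
apply: ereal_sup_ubound; exists I => //.
rewrite /emean -/u uoo gt0_muley ?lte_fin ?invr_gt0 ?dlen_gt0//.
have q10 : q - 1 != 0 by rewrite gt_eqF// subr_gt0.
rewrite /= (negbTE q10) -/(emean I v) emean_fin// gt0_muley// lte_fin.
exact: mean_gt0.
Qed.

Lemma Ad_char_fin (R : realType) (q : R) (v : R -> R) :
  1 < q -> Ad_class q v -> exists Q, [/\ Ad_char q v = Q%:E, 1 <= Q &
    forall I, mean I v * mean I (wpow v (- (q - 1)^-1)) `^ (q - 1) <= Q].
Proof.
move=> q1 Aqv; have ui := Ad_char_dual_integrable q1 Aqv.
have [[vloc v0] vq] := Aqv.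
have vi := locally_integrable_dyadic vloc.
have mv : measurable_fun [set: R] v by case: vloc.
have le_char I : ((mean I v * mean I (wpow v (- (q - 1)^-1)) `^ (q - 1))%:E <= Ad_char q v)%E.
  apply: ereal_sup_ubound; exists I => //.
  by rewrite !emean_fin// poweR_EFin EFinM.
have q10 : 0 < q - 1 by rewrite subr_gt0.
have lb := Ad_lower_bound q10 vi ui v0 (mean_gt0 (0, 0) mv vi v0).
case E : (Ad_char q v) le_char vq => [Q| |] // le_char _.
- exists Q; split=> [//||I]; last by rewrite -lee_fin.
  by apply: (le_trans lb); rewrite -lee_fin.
- by have := le_char (0, 0).
Qed.

Lemma Cd_char_fin (R : realType) (s : R) (w : R -> R) :
  Cd_class s w -> dyadic_integrable (wpow w s) ->
  exists c, [/\ Cd_char s w = c%:E, 0 <= c &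
    forall I, mean I (wpow w s) * mean I w `^ (- s) <= c].
Proof.
move=> [[wloc w0] wc] vi.
have wi := locally_integrable_dyadic wloc.
have mw : measurable_fun [set: R] w by case: wloc.
have le_char I : ((mean I (wpow w s) * mean I w `^ (- s))%:E <= Cd_char s w)%E.
  apply: ereal_sup_ubound; exists I => //.
  by rewrite !emean_fin// poweR_EFin EFinM.
have V0 I : 0 < mean I (wpow w s).
  by apply: mean_gt0 => //; [exact: measurable_wpow|exact: wpow_ae_gt0].
case E : (Cd_char s w) le_char wc => [c| |] // le_char _.
- exists c; split=> [//||I]; last by rewrite -lee_fin.
  apply: (@le_trans _ _ (mean (0, 0) (wpow w s) * mean (0, 0) w `^ (- s))).
    by rewrite mulr_ge0 ?powR_ge0// ltW.
  by rewrite -lee_fin.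
- by have := le_char (0, 0).
Qed.

Lemma esum_le_finite (R : realType) (T : choiceType) (D : set T) (a : T -> R) (M : R) :
  (forall s : seq T, uniq s -> (forall x, x \in s -> D x) -> \sum_(x <- s) a x <= M) ->
  (\esum_(x in D) (a x)%:E <= M%:E)%E.
Proof.
move=> H; apply: ge_ereal_sup => _ [F [finF FD] <-].
rewrite fsbig_finite//= sumEFin lee_fin; apply: H; first exact: finmap.fset_uniq.
by move=> x; rewrite in_fset_set// inE => /FD.
Qed.

Lemma haar_form_le (R : realType) (m n : nat) (t : R) (w f g : R -> R) (M : R) :
  (\esum_(x in form_index R m n) `|(form_term t w f g x)%:E| <= M%:E)%E ->
  form_abs_cvg m n t w f g /\ (`|haar_form m n t w f g| <= M%:E)%E.
Proof.
move=> SM; split.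
  by rewrite /form_abs_cvg /summable; apply: (le_lt_trans SM); exact: ltry.
rewrite /haar_form; set D := form_index R m n; set T := EFin \o _.
have T0 : (0 <= \esum_(x in D) (T^\+ x) <= M%:E)%E.
  apply/andP; split; first by apply: esum_ge0 => x _; exact: funepos_ge0.
  apply: le_trans SM; apply: le_esum => x _.
  by rewrite -[leRHS]/((abse \o T) x) fune_abse leeDl// funeneg_ge0.
have T1 : (0 <= \esum_(x in D) (T^\- x) <= M%:E)%E.
  apply/andP; split; first by apply: esum_ge0 => x _; exact: funeneg_ge0.
  apply: le_trans SM; apply: le_esum => x _.
  by rewrite -[leRHS]/((abse \o T) x) fune_abse leeDr// funepos_ge0.
move: T0 T1; case: (esum _ _) => [a| |]; case: (esum _ _) => [b| |];
  rewrite ?leye_eq ?leeNy_eq ?andbF//.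
rewrite !lee_fin => /andP[a0 aM] /andP[b0 bM].
rewrite ler_norml; apply/andP; lra.
Qed.

Theorem theorem1p1 (R : realType) (q : R) (q_gt1 : 1 < q) :
  exists C : R, 0 < C /\
    forall (t : R) (m n : nat) (w : R -> R),
      Cd_class (2 * t) w -> Ad_class q (wpow w (2 * t)) ->
      forall f g : R -> R,
        f \in Lfun lebesgue_measure 2%:E -> g \in Lfun lebesgue_measure 2%:E ->
        form_abs_cvg m n t w f g /\
        (`| haar_form m n t w f g | <=
          (C * (m + n + 2)%:R ^+ 3)%:E *
          Cd_char (2 * t) w `^ (2^-1) *
          Ad_char q (wpow w (2 * t)) `^ (2^-1) *
          'N[lebesgue_measure]_(2%:E)[EFin \o f] *
          'N[lebesgue_measure]_(2%:E)[EFin \o g])%E.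
Proof.
(* 2306 Q bounds the constant 2 + 2304 Q of the square function, as Q >= 1. *)
exists 2306; split; first by rewrite ltr0n.
move=> t m n w Cw Aw f g fL gL.
set v := wpow w (2 * t).
have q10 : 0 < q - 1 by rewrite subr_gt0.
have [[wloc w0] _] := Cw.
have mw : measurable_fun [set: R] w by case: wloc.
have wi := locally_integrable_dyadic wloc.
have [[vloc v0] _] := Aw.
have vi := locally_integrable_dyadic vloc.
have mv : measurable_fun [set: R] v by case: vloc.
have ui := Ad_char_dual_integrable q_gt1 Aw.
have [Q [QE Q1 vuQ]] := Ad_char_fin q_gt1 Aw.
have [c [cE c0 wc]] := Cd_char_fin Cw vi.
pose sc := Num.sqrt c; pose sQ := Num.sqrt Q.
pose a := Num.sqrt (L2sq f); pose b := Num.sqrt (L2sq g).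
have a2 : a ^+ 2 = L2sq f by rewrite sqr_sqrtr// L2sq_ge0.
have b2 : b ^+ 2 = L2sq g by rewrite sqr_sqrtr// L2sq_ge0.
have Q2 : sQ ^+ 2 = Q by rewrite sqr_sqrtr//; lra.
have c2 : sc ^+ 2 = c by rewrite sqr_sqrtr.
rewrite QE cE !Lnorm2E// !poweR_EFin !powR12_sqrt//; last by lra.
rewrite -!EFinM -/sc -/sQ -/a -/b.
have V0 I : 0 < mean I v by exact: mean_gt0.
have W0 I : 0 < mean I w by exact: mean_gt0.
have wv I : (mean I w `^ (- t)) ^+ 2 * mean I v <= sc ^+ 2.
  rewrite c2 mulrC; apply: le_trans (wc I).
  have -> : mean I w `^ (- (2 * t)) = (mean I w `^ (- t)) ^+ 2.
    rewrite expr2 -powRD; first by congr (_ `^ _); ring.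
    by apply/implyP => _; rewrite gt_eqF.
  exact: lexx.
have hv x : wpow w t x ^+ 2 = v x by rewrite wpow_sqr.
have G_le A : uniq A ->
    \sum_(J <- A) inner (fun x => g x * wpow w t x) (haar J) ^+ 2 / mean J v
    <= 2306 * (Q * L2sq g).
  move=> uA.
  have [_] := haar_square_sum q10 mv vi v0 ui vuQ (measurable_wpow t mw) hv gL uA.
  move=> /le_trans; apply; rewrite mulrA ler_wpM2r ?L2sq_ge0//; lra.
have S_le s : uniq s -> (forall x, x \in s -> form_index R m n x) ->
    \sum_(x <- s) `|form_term t w f g x| <= sc * 2306 * (a * (sQ * b)).
  move=> us sD; apply: le_of_amgm.
  - exact: (mulr_ge0 (sqrtr_ge0 c) (ler0n R 2306)).
  - exact: sqrtr_ge0.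
  - exact: (mulr_ge0 (sqrtr_ge0 Q) (sqrtr_ge0 _)).
  move=> e e0.
  apply: le_trans (form_sum_le (sqrtr_ge0 c) (mean_avg vi) V0 wv
    (fun A uA => haar_bessel fL uA) G_le e0 us sD) _.
  rewrite exprMn a2 b2 Q2 -/sc le_eqVlt; apply/orP; left; apply/eqP.
  by field; rewrite gt_eqF.
have /haar_form_le[h1 h2] : (\esum_(x in form_index R m n)
    `|(form_term t w f g x)%:E| <= (sc * 2306 * (a * (sQ * b)))%:E)%E.
  exact: esum_le_finite S_le.
split=> //; apply: (le_trans h2); rewrite lee_fin.
have P0 : 0 <= sc * sQ * a * b by do 3 ?[apply: mulr_ge0]; exact: sqrtr_ge0.
have N1 : 1 <= (m + n + 2)%:R ^+ 3 :> R.
  by rewrite exprn_ege1// ler1n addn2.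
set N := (m + n + 2)%:R ^+ 3 in N1 *; set K : R := 2306.
have K0 : 0 <= K := ler0n R 2306.
have -> : sc * K * (a * (sQ * b)) = K * (sc * sQ * a * b) by ring.
have -> : K * N * sc * sQ * a * b = K * (N * (sc * sQ * a * b)) by ring.
by apply: (ler_wpM2l K0); rewrite -[leLHS]mul1r; exact: ler_wpM2r.
Qed.
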